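(* Let $G=(V,E)$ be a countably infinite connected graph with finite degrees, $(G_n)_{n\ge1}$ an exhaustion of $G$ by finite subgraphs, and $w$ a non-negative weight function on oriented cycles of $G$. Assume that a sequence $(\mu_n)_{n\ge1}$ of probability measures on cycle-rooted spanning forests of $G_n$, associated with $w$ in that $\mu_n$ is supported on CRSFs of $G_n$ all of whose cycles have non-trivial weight, converges weakly to a measure $\mu$, and let $F$ be distributed according to $\mu$. Then, $\mu$-almost surely, every finite connected component of $F$ has exactly one cycle, and its cycle has non-trivial weight.
   Context: A cycle-rooted spanning forest (CRSF) of a graph $H$ is a subgraph containing all vertices of $H$, each of whose connected components contains exactly one cycle. The exhaustion $(G_n)$ is an increasing sequence of finite subgraphs of $G$ (connected and induced) whose union is $G$. An unoriented cycle $[\gamma]$ with orientations $\gamma,\gamma^{-1}$ has trivial weight if $w(\gamma)+w(\gamma^{-1})=0$, and non-trivial weight otherwise. (Typical example: $\mu_n(F)\propto\prod_{[\gamma]\in\mathcal C(F)}(w(\gamma)+w(\gamma^{-1}))$, where $\mathcal C(F)$ is the set of unoriented cycles of $F$.) Subgraphs of $G$ are identified with elements of $\Omega=\{0,1\}^E$ (subgraphs of $G_n$ being extended by $0$ outside $G_n$), endowed with the product topology and the cylinder $\sigma$-field. $\mu_n\to\mu$ weakly means $\int f\,d\mu_n\to\int f\,d\mu$ for every local function $f$, i.e. every $f$ depending on finitely many edges. In the random configuration $F$, every vertex of $G$ is present. *)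

(* Defs.v *)
From HB Require Import structures.
From Stdlib Require Export Relation_Operators.
From mathcomp Require Export all_boot all_order all_algebra.
From mathcomp Require Export all_classical all_reals all_analysis.

Set Implicit Arguments.
Unset Strict Implicit.
Unset Printing Implicit Defensive.

Import Order.TTheory GRing.Theory Num.Theory.
Import numFieldNormedType.Exports.

Local Open Scope classical_set_scope.
Local Open Scope ring_scope.

(** A graph with vertex type [V] and edge type [E] is given by [ends : E -> V * V].
    Multiple edges and loops are allowed; a simple graph is the special case where
    no two edges have the same pair of ends and no edge has equal ends.  The order
    of the two ends of an edge has no meaning beyond naming its two orientations:
    [(e, true)] runs from [(ends e).1] to [(ends e).2], and [(e, false)] runs
    backwards. *)
Definition dart (E : Type) : Type := (E * bool)%type.

Definition dtail (V E : Type) (ends : E -> V * V) (d : dart E) : V :=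
  if d.2 then (ends d.1).1 else (ends d.1).2.

Definition dhead (V E : Type) (ends : E -> V * V) (d : dart E) : V :=
  if d.2 then (ends d.1).2 else (ends d.1).1.

Definition finite_degrees (V E : Type) (ends : E -> V * V) : Prop :=
  forall v, finite_set [set e | (ends e).1 = v \/ (ends e).2 = v].

(** The condition that the ends of the edges be vertices is not part of the record;
    it follows from [induced] for the members of an exhaustion, and from the
    inclusion of edge sets for the spanning subgraphs considered below. *)
Record subgraph (V E : Type) := Subgraph { verts : set V ; edges : set E }.

Definition whole (V E : Type) : subgraph V E := Subgraph setT setT.

Definition induced (V E : Type) (ends : E -> V * V) (H : subgraph V E) : Prop :=
  edges H = [set e | verts H (ends e).1 /\ verts H (ends e).2].

Definition finite_subgraph (V E : Type) (H : subgraph V E) : Prop :=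
  finite_set (verts H) /\ finite_set (edges H).

Definition adjacent (V E : Type) (ends : E -> V * V) (H : subgraph V E)
    (u v : V) : Prop :=
  exists d : dart E, [/\ edges H d.1, dtail ends d = u & dhead ends d = v].

Definition linked (V E : Type) (ends : E -> V * V) (H : subgraph V E) :
    V -> V -> Prop :=
  clos_refl_trans V (adjacent ends H).

Definition connected_graph (V E : Type) (ends : E -> V * V) (H : subgraph V E) :
    Prop :=
  forall u v, verts H u -> verts H v -> linked ends H u v.

Definition component (V E : Type) (ends : E -> V * V) (H : subgraph V E) (v : V) :
    subgraph V E :=
  Subgraph [set u | verts H u /\ linked ends H v u]
           [set e | edges H e /\ linked ends H v (ends e).1].

Definition exhaustion (V E : Type) (ends : E -> V * V) (G : nat -> subgraph V E) :
    Prop :=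
  [/\ forall n, [/\ finite_subgraph (G n), connected_graph ends (G n)
                  & induced ends (G n)],
      forall n, verts (G n) `<=` verts (G n.+1) /\ edges (G n) `<=` edges (G n.+1)
    & \bigcup_n verts (G n) = setT /\ \bigcup_n edges (G n) = setT].

(** An oriented cycle with a marked starting point: a closed walk with no repeated
    vertex and no repeated edge.  Edges need a separate condition only to exclude
    going back and forth along a single edge. *)
Definition oriented_cycle (V E : eqType) (ends : E -> V * V) (c : seq (dart E)) :
    Prop :=
  [/\ c != [::],
      path.cycle (fun d d' => dhead ends d == dtail ends d') c,
      uniq [seq dtail ends d | d <- c]
    & uniq [seq d.1 | d <- c]].

Definition reverse_cycle (E : Type) (c : seq (dart E)) : seq (dart E) :=
  rev [seq (d.1, ~~ d.2) | d <- c].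

(** The unoriented cycle underlying [c], as the set of all its representatives:
    every starting point, both orientations. *)
Definition unoriented (E : Type) (c : seq (dart E)) : set (seq (dart E)) :=
  [set c' | exists k, c' = rot k c \/ c' = rot k (reverse_cycle c)].

Definition cycles_of (V E : eqType) (ends : E -> V * V) (H : subgraph V E) :
    set (seq (dart E)) :=
  [set c | oriented_cycle ends c /\ forall d, d \in c -> edges H d.1].

Definition unoriented_cycles_of (V E : eqType) (ends : E -> V * V)
    (H : subgraph V E) : set (set (seq (dart E))) :=
  [set unoriented c | c in cycles_of ends H].

Definition exactly_one_cycle (V E : eqType) (ends : E -> V * V)
    (H : subgraph V E) : Prop :=
  exists! C, unoriented_cycles_of ends H C.

(** A non-negative function of oriented cycles, hence independent of the starting
    point; its values on sequences that are not cycles are irrelevant. *)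
Definition weight_function (R : realType) (V E : eqType) (ends : E -> V * V)
    (w : seq (dart E) -> R) : Prop :=
  forall c, oriented_cycle ends c -> 0 <= w c /\ forall k, w (rot k c) = w c.

Definition trivial_weight (R : realType) (E : Type) (w : seq (dart E) -> R)
    (c : seq (dart E)) : Prop :=
  w c + w (reverse_cycle c) = 0.

Definition local (E T : Type) (f : (E -> bool) -> T) : Prop :=
  exists2 S : set E, finite_set S &
    forall F F' : E -> bool, (forall e, S e -> F e = F' e) -> f F = f F'.

Definition cylinders (E : Type) : set (set (E -> bool)) :=
  [set A : set (E -> bool) | local A].

(** [{0,1}^E] with the cylinder sigma-field. *)
Definition config (E : Type) := g_sigma_algebraType (@cylinders E).

(** The subgraph with all the vertices of [H] and the open edges of [F]. *)
Definition spanning (V E : Type) (H : subgraph V E) (F : E -> bool) :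
    subgraph V E :=
  Subgraph (verts H) [set e | F e].

Definition crsf (V E : eqType) (ends : E -> V * V) (H : subgraph V E)
    (F : E -> bool) : Prop :=
  (forall e, F e -> edges H e) /\
  forall v, verts H v -> exactly_one_cycle ends (component ends (spanning H F) v).

Definition weakly_converges (R : realType) (E : Type)
    (mu_ : nat -> probability (config E) R)
    (mu : {measure set (config E) -> \bar R}) : Prop :=
  forall f : (E -> bool) -> R, local f ->
    (fun n => \int[mu_ n]_F (f F)%:E)%E @ \oo --> (\int[mu]_F (f F)%:E)%E.

(* Main.v *)
Require Import Defs.
From Stdlib Require Import Operators_Properties.
From mathcomp Require Import all_boot all_order all_algebra.
From mathcomp Require Import all_classical all_reals all_analysis.

Set Implicit Arguments.
Unset Strict Implicit.
Unset Printing Implicit Defensive.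

Local Open Scope classical_set_scope.
Local Open Scope ring_scope.

(** Suppose that the component of [v] in a configuration [F] is a finite graph
    [K] that violates the conclusion.  Finitely many edges have an end in [K],
    because degrees are finite, and their states alone make [K] the component
    of [v] ([component_local]).  So the configurations that agree with [F] on
    those edges form a cylinder, all of whose elements have the bad component
    [K] at [v].

    For all [n] so large that [v] lies in [G_n], this cylinder is [mu_n]-null:
    a CRSF of [G_n] with non-trivial cycle weights has no bad component, and its
    component at [v] is the same whether it is regarded as a subgraph of [G_n]
    or of [G] ([component_spanning_whole]).  The indicator of a cylinder is a
    test function for weak convergence, hence the cylinder is [mu]-null as well
    ([weak_limit_null]).

    There are only countably many cylinders, so almost surely [F] avoids all
    the null ones ([ae_avoids_null_cylinders]), and in particular has no bad
    finite component. *)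

(** A walk from [v] can only leave the component of [v] through an edge with an
    end in it; so if the states of those edges are unchanged, the component is
    the same. *)
Lemma component_local (V E : Type) (ends : E -> V * V) (H : subgraph V E)
    (F F' : E -> bool) (v : V) :
    (forall e, linked ends (spanning H F) v (ends e).1 \/
               linked ends (spanning H F) v (ends e).2 -> F e = F' e) ->
  component ends (spanning H F) v = component ends (spanning H F') v.
Proof.
move=> FF'.
have FF'_dart d : linked ends (spanning H F) v (dtail ends d) ->
    F d.1 = F' d.1.
  by case: d => e [] vd; apply: FF'; [left | right].
have linkedE u : linked ends (spanning H F) v u =
                 linked ends (spanning H F') v u.
  apply/propext; split=> vu; have := clos_rt_rtn1 _ _ _ _ vu.
  - elim=> [|y z [d [/= Fd dy dz]] vy IH]; first exact: rt_refl.
    apply: rt_trans IH _; apply: rt_step; exists d; split=> //=.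
    by rewrite -FF'_dart ?dy //; exact: clos_rtn1_rt.
  - elim=> [|y z [d [/= Fd dy dz]] _ vy]; first exact: rt_refl.
    apply: rt_trans (vy) _; apply: rt_step; exists d; split=> //=.
    by rewrite FF'_dart ?dy.
rewrite /component; congr (Subgraph _ _); apply/seteqP.
  by split=> u /=; rewrite linkedE.
split=> e /= [Fe ve]; split.
- by rewrite -FF' //; left.
- by rewrite -linkedE.
- by rewrite FF' //; left; rewrite linkedE.
- by rewrite linkedE.
Qed.

(** The open edges alone determine which vertices are linked, and they never
    lead out of [H] when all of them join vertices of [H]. *)
Lemma component_spanning_whole (V E : Type) (ends : E -> V * V)
    (H : subgraph V E) (F : E -> bool) (v : V) :
    Defs.induced ends H -> (forall e, F e -> edges H e) -> verts H v ->
  component ends (spanning H F) v =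
  component ends (spanning (whole V E) F) v.
Proof.
move=> Hind FH Hv; rewrite /component; congr (Subgraph _ _).
apply/seteqP; split=> u /= [_ vu]; split=> //.
case: (clos_rt_rtn1 _ _ _ _ vu) => // y z [[e b] [/= /FH]].
by rewrite Hind => -[He1 He2] _ <- _; case: b.
Qed.

Lemma cycles_of_component (V E : eqType) (ends : E -> V * V)
    (H : subgraph V E) (v : V) :
  cycles_of ends (component ends H v) `<=` cycles_of ends H.
Proof. by move=> c [c_cycle cH]; split=> // d /cH []. Qed.

Lemma finite_incident_edges (V E : Type) (ends : E -> V * V) (K : set V) :
    finite_degrees ends -> finite_set K ->
  finite_set [set e | K (ends e).1 \/ K (ends e).2].
Proof.
move=> deg finK.
apply: (sub_finite_set _ (bigcup_finite finK (fun v _ => deg v))) => e /=.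
by case=> Ke; [exists (ends e).1 | exists (ends e).2] => //=; [left | right].
Qed.

Lemma exhaustion_eventually (V E : Type) (ends : E -> V * V)
    (G : nat -> subgraph V E) (v : V) :
  exhaustion ends G -> \forall n \near \oo, verts (G n) v.
Proof.
move=> [_ G_incr [G_verts _]].
have [m _ Gmv] : (\bigcup_n verts (G n)) v by rewrite G_verts.
exists m => // n /= /subnKC <-; elim: (n - m)%N => [|k IH].
  by rewrite addn0.
by rewrite addnS; apply: (G_incr _).1.
Qed.

(** The open edges among those of [s] are recorded as a second list, rather
    than as a function on [s], so that pairs of lists enumerate the cylinders. *)
Definition cylinder (E : eqType) (s t : seq E) : set (config E) :=
  [set F : config E | forall e, e \in s -> F e = (e \in t)].

Lemma local_cylinder (E : choiceType) (s t : seq E) : local (cylinder s t).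
Proof.
exists [set` s]; first exact: finite_seq.
by move=> F F' FF'; apply/propext; split=> sF e es;
  [rewrite -FF' | rewrite FF'] => //; exact: sF.
Qed.

Lemma mem_cylinder (E : eqType) (s : seq E) (F : config E) :
  cylinder s [seq e <- s | F e] F.
Proof. by move=> e es; rewrite mem_filter es andbT. Qed.

Lemma local_measurable (E : Type) (A : set (config E)) :
  local A -> measurable A.
Proof. exact: sub_sigma_algebra. Qed.

(** The indicator of a set fixed by finitely many edges is a local test
    function, so the measures of such a set converge along with the integrals.
    For other null sets this fails. *)
Lemma weak_limit_null (R : realType) (E : Type)
    (mu_ : nat -> probability (config E) R)
    (mu : {measure set (config E) -> \bar R}) (A : set (config E)) :
    weakly_converges mu_ mu -> local A ->
    (\forall n \near \oo, mu_ n A = 0%E) -> mu A = 0%E.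
Proof.
move=> mu_cvg locA muA0.
have mA := local_measurable locA.
have [S finS AS] := locA.
have /mu_cvg : local (\1_A : config E -> R).
  by exists S => // F F' /AS AFF'; rewrite !indicE /in_mem /= /in_set AFF'.
rewrite integral_indic // setIT => /cvg_unique; apply=> //.
apply: cvg_near_cst; near=> n.
by rewrite integral_indic // setIT; near: n.
Unshelve. all: by end_near. Qed.

Lemma ae_avoids_null_cylinders (R : realType) (E : countType)
    (mu : {measure set (config E) -> \bar R}) :
  {ae mu, forall F : config E, forall s t : seq E,
     mu (cylinder s t) = 0%E -> ~ cylinder s t F}.
Proof.
pose N (n : nat) : set (config E) :=
  if unpickle n is Some (s, t) then
    [set F | mu (cylinder s t) = 0%E /\ cylinder s t F]
  else set0.
apply: (@negligibleS _ _ _ mu (\bigcup_n N n)).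
  move=> F /= notF; apply: contrapT => NF; apply: notF => s t st0 sF.
  by apply: NF; exists (pickle (s, t)) => //; rewrite /N pickleK.
apply: negligible_bigcup => n; rewrite /N.
case: (unpickle n) => [[s t]|]; last exact: negligible_set0.
have [st0|st0] := EM (mu (cylinder s t) = 0%E).
  exists (cylinder s t); split=> //.
    by apply: local_measurable; exact: local_cylinder.
  by move=> F [].
by apply: negligibleS (negligible_set0 mu) => F [].
Qed.

Theorem proposition3p1p1 (R : realType) (V E : countType) (ends : E -> V * V)
  (V_infinite : infinite_set [set: V])
  (G_connected : connected_graph ends (whole V E))
  (G_degrees : finite_degrees ends)
  (G_ : nat -> subgraph V E) (G_exhaustion : exhaustion ends G_)
  (w : seq (dart E) -> R) (w_weight : weight_function ends w)
  (mu_ : nat -> probability (config E) R)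
  (mu_crsf : forall n, {ae mu_ n, forall F : config E,
     crsf ends (G_ n) F /\
     forall c, cycles_of ends (spanning (G_ n) F) c -> ~ trivial_weight w c})
  (mu : {measure set (config E) -> \bar R})
  (mu_cvg : weakly_converges mu_ mu) :
  {ae mu, forall F : config E, forall v : V,
     finite_subgraph (component ends (spanning (whole V E) F) v) ->
     exactly_one_cycle ends (component ends (spanning (whole V E) F) v) /\
     forall c, cycles_of ends (component ends (spanning (whole V E) F) v) c ->
       ~ trivial_weight w c}.
Proof.
apply: filterS (ae_avoids_null_cylinders mu) => F F_avoids v [finK _].
apply: contrapT => bad.
have /finite_seqP[s sE] := finite_incident_edges G_degrees finK.
pose A := cylinder s [seq e <- s | F e].
apply: (F_avoids s [seq e <- s | F e]); last exact: mem_cylinder.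
have locA : local A by exact: local_cylinder.
have component_A F' : A F' -> component ends (spanning (whole V E) F) v =
                              component ends (spanning (whole V E) F') v.
  move=> AF'; apply: component_local => e ve.
  have es : e \in s.
    by suff : [set` s] e by []; rewrite -sE /=; case: ve; [left | right].
  by rewrite AF' // mem_filter es andbT.
(* Under [mu_n], an element of [A] outside a null set would be a CRSF with
   the bad component of [F] at [v]. *)
apply: (weak_limit_null mu_cvg locA).
apply: filterS (exhaustion_eventually v G_exhaustion) => n Gnv.
have [/(_ n)[_ _ Gn_induced] _ _] := G_exhaustion.
apply: measure_negligible; first exact: local_measurable.
apply: negligibleS (mu_crsf n) => F' /component_A KF' /= [[F'G F'_cycle] F'_w].
apply: bad; rewrite KF' -(component_spanning_whole Gn_induced F'G Gnv).
by split=> [|c /cycles_of_component]; [exact: F'_cycle | exact: F'_w].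
Qed.
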